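(* Suppose $f+R$ satisfies the Kurdyka–Łojasiewicz condition with exponent $1/2$ and constant $\mu>0$: for every $x\in\mathbb{R}^d$ and every $u\in\partial R(x)$, $\|\nabla f(x)+u\|^2\ge2\mu\big(f(x)+R(x)-f^\star-R^\star\big)$, where $f^\star=f(x^\star)$, $R^\star=R(x^\star)$ for a minimizer $x^\star$ of $f+R$. In EF-BV, suppose $\nu\in(0,1]$, $\lambda\in(0,1]$ is such that $r<1$, and $$0<\gamma\le\frac{1}{2L+\tilde L\sqrt{\frac{r_{\mathrm{av}}}{r}}\frac{1}{s^\star}}.$$ For $t\ge0$ define $\Psi^t=f(x^t)+R(x^t)-f^\star-R^\star+\frac{\gamma}{2\theta^\star}\frac1n\sum_{i=1}^n\|\nabla f_i(x^t)-h_i^t\|^2$. Then for every $t\ge0$, $$\mathbb{E}[\Psi^t]\le\Big(\max\Big(\frac{1}{1+\frac12\gamma\mu},\frac{r+1}{2}\Big)\Big)^t\Psi^0.$$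
   Context: Problem setting: $f=\frac1n\sum_{i=1}^nf_i$, where each $f_i:\mathbb{R}^d\to\mathbb{R}$ is convex and $L_i$-smooth (differentiable with $L_i$-Lipschitz gradient); $\tilde L=\sqrt{\frac1n\sum_iL_i^2}$ and $f$ is $L$-smooth with $L\le\tilde L$; $R:\mathbb{R}^d\to\mathbb{R}\cup\{+\infty\}$ is proper closed convex, $\mathrm{prox}_{\gamma R}(x)=\arg\min_y(\gamma R(y)+\frac12\|x-y\|^2)$, and a minimizer of $f+R$ exists. For $\eta\in[0,1)$, $\omega\ge0$, $\mathbb{C}(\eta,\omega)$ is the class of randomized operators $\mathcal{C}:\mathbb{R}^d\to\mathbb{R}^d$ with $\|\mathbb{E}[\mathcal{C}(x)]-x\|\le\eta\|x\|$ and $\mathbb{E}\|\mathcal{C}(x)-\mathbb{E}[\mathcal{C}(x)]\|^2\le\omega\|x\|^2$ for all $x$. Compressors $\mathcal{C}_i^t$ ($i=1,\dots,n$, $t\ge0$) all lie in $\mathbb{C}(\eta,\omega)$; those used at iteration $t$ are independent of all randomness of previous iterations; $\omega_{\mathrm{av}}\in[0,\omega]$ satisfies, for every $t$ and all $x_1,\dots,x_n$, $\mathbb{E}\|\frac1n\sum_i(\mathcal{C}_i^t(x_i)-\mathbb{E}[\mathcal{C}_i^t(x_i)])\|^2\le\frac{\omega_{\mathrm{av}}}{n}\sum_i\|x_i\|^2$. Algorithm EF-BV: given $x^0,h_1^0,\dots,h_n^0$, $\gamma>0$, $\lambda,\nu\in(0,1]$, $h^0=\frac1n\sum_ih_i^0$;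 for $t\ge0$: $d_i^t=\mathcal{C}_i^t(\nabla f_i(x^t)-h_i^t)$, $h_i^{t+1}=h_i^t+\lambda d_i^t$, $d^t=\frac1n\sum_id_i^t$, $h^{t+1}=h^t+\lambda d^t$, $g^{t+1}=h^t+\nu d^t$, $x^{t+1}=\mathrm{prox}_{\gamma R}(x^t-\gamma g^{t+1})$. Constants: $r=(1-\lambda+\lambda\eta)^2+\lambda^2\omega$, $r_{\mathrm{av}}=(1-\nu+\nu\eta)^2+\nu^2\omega_{\mathrm{av}}$, $s^\star=\sqrt{\frac{1+r}{2r}}-1$, $\theta^\star=s^\star(1+s^\star)\frac{r}{r_{\mathrm{av}}}$ (with $r>0$ and $r_{\mathrm{av}}>0$ so these are finite and positive). *)

(* Defs.v *)
From HB Require Import structures.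
From mathcomp Require Import all_boot all_order all_algebra.
From mathcomp Require Import all_classical all_reals all_analysis.
Set Implicit Arguments. Unset Strict Implicit. Unset Printing Implicit Defensive.
Import Order.TTheory GRing.Theory Num.Theory.
Import numFieldNormedType.Exports.
Local Open Scope classical_set_scope.
Local Open Scope ring_scope.

Section EFBV.
Variable R : realType.
Variable d : nat.
Local Notation vec := 'rV[R]_d.

Definition dotv (u v : vec) : R := \sum_(j < d) u ord0 j * v ord0 j.
Definition sqnorm (v : vec) : R := dotv v v.
Definition enorm (v : vec) : R := Num.sqrt (sqnorm v).

Definition convex_fun (g : vec -> R) : Prop :=
  forall (x y : vec) (a : R), 0 <= a <= 1 ->
    g (a *: x + (1 - a) *: y) <= a * g x + (1 - a) * g y.

Definition is_gradient (g : vec -> R) (gr : vec -> vec) : Prop :=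
  forall x : vec, differentiable g x /\ forall v : vec, 'd g x v = dotv (gr x) v.

Definition lipschitz_map (gr : vec -> vec) (K : R) : Prop :=
  forall x y : vec, enorm (gr x - gr y) <= K * enorm (x - y).

Definition proper_ext (g : vec -> \bar R) : Prop :=
  (forall x, g x != -oo%E) /\ exists x, g x \is a fin_num.

Definition convex_ext (g : vec -> \bar R) : Prop :=
  forall (x y : vec) (a : R), 0 <= a <= 1 ->
    (g (a *: x + (1 - a) *: y)%R <= a%:E * g x + (1 - a)%:E * g y)%E.

Definition closed_ext (g : vec -> \bar R) : Prop :=
  closed [set p : vec * R | (g p.1 <= p.2%:E)%E].

Definition subdiff (g : vec -> \bar R) (x : vec) : set vec :=
  [set u | forall y : vec, (g x + (dotv u (y - x)%R)%:E <= g y)%E].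

Definition prox (gamma : R) (g : vec -> \bar R) (v : vec) : vec :=
  xget 0 [set y | forall z : vec,
    (gamma%:E * g y + (sqnorm (v - y)%R / 2)%R%:E
      <= gamma%:E * g z + (sqnorm (v - z)%R / 2)%R%:E)%E].

Variable n : nat.

Definition favg (f : 'I_n -> vec -> R) (x : vec) : R :=
  n%:R^-1 * \sum_(i < n) f i x.
Definition gavg (gr : 'I_n -> vec -> vec) (x : vec) : vec :=
  n%:R^-1 *: \sum_(i < n) gr i x.
Definition Ltilde (Li : 'I_n -> R) : R :=
  Num.sqrt (n%:R^-1 * \sum_(i < n) Li i ^+ 2).

Definition is_minimizer (F : vec -> R) (g : vec -> \bar R) (xs : vec) : Prop :=
  forall x : vec, ((F xs)%:E + g xs <= (F x)%:E + g x)%E.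

Definition KL_half (F : vec -> R) (gF : vec -> vec) (g : vec -> \bar R)
    (xs : vec) (mu : R) : Prop :=
  forall (x u : vec), subdiff g x u ->
    ((2 * mu)%:E * ((F x)%:E + g x - (F xs)%:E - g xs)
      <= (sqnorm (gF x + u)%R)%:E)%E.

Definition rconst (a eta om : R) : R := (1 - a + a * eta) ^+ 2 + a ^+ 2 * om.
Definition sstar (r : R) : R := Num.sqrt ((1 + r) / (2 * r)) - 1.
Definition thetastar (r rav : R) : R := sstar r * (1 + sstar r) * (r / rav).

Variables (dT : measure_display) (T : measurableType dT).

Definition Evec (P : probability T R) (X : T -> vec) : vec :=
  \row_(j < d) Rintegral P setT (fun s => X s ord0 j).

(** the class C(eta, omega) for a random operator s |-> Cop s (seed law P);
    integrability of the components expresses that E[C(x)] exists. *)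
Definition compressor_class (P : probability T R) (Cop : T -> vec -> vec)
    (eta om : R) : Prop :=
  (forall (x : vec) (j : 'I_d), P.-integrable setT (fun s => (Cop s x ord0 j)%:E)) /\
  (forall x : vec, enorm (Evec P (fun s => Cop s x) - x) <= eta * enorm x) /\
  (forall x : vec,
     (integral P setT (fun s => (sqnorm (Cop s x - Evec P (fun s => Cop s x))%R)%:E)
       <= (om * sqnorm x)%:E)%E).

Definition omega_av_bound (P : probability T R) (Cs : 'I_n -> T -> vec -> vec)
    (omav : R) : Prop :=
  forall xs : 'I_n -> vec,
    (integral P setT (fun s => (sqnorm (n%:R^-1 *:
        \sum_(i < n) (Cs i s (xs i) - Evec P (fun s' => Cs i s' (xs i)))))%:E)
      <= (omav / n%:R * \sum_(i < n) sqnorm (xs i))%:E)%E.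

(** EF-BV. State = (x^t, (h_i^t)_i, h^t). [Cm i] is the realized compressor. *)
Definition efbv_step (gradf : 'I_n -> vec -> vec) (g : vec -> \bar R)
    (gamma lam nu : R) (Cm : 'I_n -> vec -> vec)
    (st : vec * ('I_n -> vec) * vec) : vec * ('I_n -> vec) * vec :=
  let: (x, hs, hb) := st in
  let di := fun i => Cm i (gradf i x - hs i) in
  let db := n%:R^-1 *: \sum_(i < n) di i in
  let gg := hb + nu *: db in
  (prox gamma g (x - gamma *: gg), (fun i => hs i + lam *: di i), hb + lam *: db).

(** iterates as functions of the seed sequence xi (xi t = seed of iteration t;
    the seeds of distinct iterations are independent, see Eiter). *)
Fixpoint efbv_state (gradf : 'I_n -> vec -> vec) (g : vec -> \bar R)
    (gamma lam nu : R) (C : nat -> 'I_n -> T -> vec -> vec)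
    (x0 : vec) (h0 : 'I_n -> vec) (t : nat) (xi : nat -> T)
    : vec * ('I_n -> vec) * vec :=
  match t with
  | 0 => (x0, h0, n%:R^-1 *: \sum_(i < n) h0 i)
  | t'.+1 => efbv_step gradf g gamma lam nu (fun i => C t' i (xi t'))
               (efbv_state gradf g gamma lam nu C x0 h0 t' xi)
  end.

Definition upd (xi : nat -> T) (k : nat) (s : T) : nat -> T :=
  fun m => if m == k then s else xi m.

(** Eiter P m k G xi = integral of G over the seeds xi_k, ..., xi_(k+m-1),
    drawn independently with laws P k, ..., P (k+m-1).  *)
Fixpoint Eiter (P : nat -> probability T R) (m k : nat)
    (G : (nat -> T) -> \bar R) (xi : nat -> T) {struct m} : \bar R :=
  match m with
  | 0 => G xi
  | m'.+1 => integral (P k) setT (fun s => Eiter P m' k.+1 G (upd xi k s))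
  end.

Definition Psi (f : 'I_n -> vec -> R) (gradf : 'I_n -> vec -> vec)
    (g : vec -> \bar R) (xs : vec) (gamma lam nu theta : R)
    (C : nat -> 'I_n -> T -> vec -> vec) (x0 : vec) (h0 : 'I_n -> vec)
    (t : nat) (xi : nat -> T) : \bar R :=
  let: (x, hs, _) := efbv_state gradf g gamma lam nu C x0 h0 t xi in
  ((favg f x)%:E + g x - (favg f xs)%:E - g xs
   + (gamma / (2 * theta) * (n%:R^-1 * \sum_(i < n) sqnorm (gradf i x - hs i)))%:E)%E.

End EFBV.

(* Main.v *)
(* One step of EF-BV is analysed against an arbitrary comparison point y.  With
   u the subgradient of R at x' = prox(x - gamma v), convexity of f and R and the
   smoothness of f give, for the gap D = f + R - f* - R*,
     D(x') + (1 - 2 gamma L)/(2 gamma) |x' - x|^2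
       <= D(y) + |y - x|^2/(2 gamma) + (gamma/2) |grad f(x) - v|^2.
   The first two terms on the right are the Moreau envelope of D at x, and the
   Kurdyka-Lojasiewicz inequality bounds its minimum over y by
   D(x)/(1 + gamma mu/2).  This way the factor 1/(1 + gamma mu/2) never multiplies
   the negative term in |x' - x|^2, which has to absorb the drift of the gradients
   in the control-variate error.  The bound obtained for Psi at x' is a quadratic
   function of the compressed vectors, so its mean follows from the bias-variance
   decomposition, and no measurability of the proximal iterates is needed. *)
Require Import Defs.
From HB Require Import structures.
From mathcomp Require Import all_boot all_order all_algebra.
From mathcomp Require Import all_classical all_reals all_analysis.
From mathcomp Require Import measurable_realfun ring lra.
Import Order.TTheory GRing.Theory Num.Theory.
Import numFieldNormedType.Exports.
Local Open Scope classical_set_scope.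
Local Open Scope ring_scope.

(** * Inner products and norms in Euclidean space *)

Section EuclideanVectors.
Context {R : realType} {d : nat}.
Implicit Types (u v w : 'rV[R]_d) (a b : R).

Lemma dotvC u v : dotv u v = dotv v u.
Proof. by apply: eq_bigr => j _; rewrite mulrC. Qed.

Lemma dotvDl u v w : dotv (u + v) w = dotv u w + dotv v w.
Proof. by rewrite /dotv -big_split; apply: eq_bigr => j _; rewrite mxE mulrDl. Qed.

Lemma dotvZl a u v : dotv (a *: u) v = a * dotv u v.
Proof. by rewrite /dotv mulr_sumr; apply: eq_bigr => j _; rewrite mxE mulrA. Qed.

Lemma dot0v v : dotv 0 v = 0.
Proof. by rewrite -(scale0r v) dotvZl mul0r. Qed.

Lemma dotvNl u v : dotv (- u) v = - dotv u v.
Proof. by rewrite -scaleN1r dotvZl mulN1r. Qed.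

Lemma dotvDr u v w : dotv w (u + v) = dotv w u + dotv w v.
Proof. by rewrite dotvC dotvDl !(dotvC w). Qed.

Lemma dotvZr a u v : dotv v (a *: u) = a * dotv v u.
Proof. by rewrite dotvC dotvZl (dotvC v). Qed.

Lemma dotvNr u v : dotv v (- u) = - dotv v u.
Proof. by rewrite dotvC dotvNl (dotvC v). Qed.

Definition dotvE := (dotvDl, dotvDr, dotvZl, dotvZr, dotvNl, dotvNr).

Lemma dotv_suml (I : finType) (F : I -> 'rV[R]_d) v :
  dotv (\sum_i F i) v = \sum_i dotv (F i) v.
Proof.
rewrite /dotv exchange_big /=; apply: eq_bigr => j _.
by rewrite summxE mulr_suml.
Qed.

Lemma sqnorm_ge0 u : 0 <= sqnorm u.
Proof. by apply: sumr_ge0 => j _; rewrite -expr2 sqr_ge0. Qed.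

Lemma sqnormZ a u : sqnorm (a *: u) = a ^+ 2 * sqnorm u.
Proof. by rewrite /sqnorm !dotvE mulrA expr2. Qed.

Lemma sqnormN u : sqnorm (- u) = sqnorm u.
Proof. by rewrite -scaleN1r sqnormZ sqrrN expr1n mul1r. Qed.

Lemma sqnormD u v : sqnorm (u + v) = sqnorm u + 2 * dotv u v + sqnorm v.
Proof. rewrite /sqnorm !dotvE (dotvC v u); ring. Qed.

Lemma sqnormB u v : sqnorm (u - v) = sqnorm u - 2 * dotv u v + sqnorm v.
Proof. rewrite /sqnorm !dotvE (dotvC v u); ring. Qed.

Lemma dotv_young a u v : 0 < a ->
  2 * dotv u v <= a * sqnorm u + a^-1 * sqnorm v.
Proof.
move=> a0; have /(mulr_ge0 (ltW a0)) := sqnorm_ge0 (u - a^-1 *: v).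
rewrite sqnormB sqnormZ dotvZr => h.
have -> : a^-1 * sqnorm v = a * (a^-1 ^+ 2 * sqnorm v) by field; rewrite gt_eqF.
have : a * (2 * (a^-1 * dotv u v)) = 2 * dotv u v by field; rewrite gt_eqF.
by lra.
Qed.

Lemma enorm_ge0 u : 0 <= enorm u. Proof. exact: sqrtr_ge0. Qed.

Lemma enormN u : enorm (- u) = enorm u. Proof. by rewrite /enorm sqnormN. Qed.

Lemma sqr_enorm u : enorm u ^+ 2 = sqnorm u.
Proof. by rewrite sqr_sqrtr ?sqnorm_ge0. Qed.

(** Young's inequality at its optimal weight [enorm v / enorm u]. If one norm vanishes, Young's
    inequality with another weight excludes a positive inner product. *)
Lemma cauchy_schwarz u v : dotv u v <= enorm u * enorm v.
Proof.
have := enorm_ge0 u; rewrite le_eqVlt => /predU1P[u0|u0]; last first.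
  have := enorm_ge0 v; rewrite le_eqVlt => /predU1P[v0|v0]; last first.
    have := dotv_young (enorm v / enorm u) u v (divr_gt0 v0 u0).
    rewrite -!sqr_enorm invf_div.
    have -> : enorm v / enorm u * enorm u ^+ 2 + enorm u / enorm v * enorm v ^+ 2
        = 2 * (enorm u * enorm v) by field; rewrite !gt_eqF.
    by lra.
  have sv : sqnorm v = 0 by rewrite -sqr_enorm -v0 expr0n.
  rewrite -v0 mulr0 leNgt; apply/negP => uv.
  have a0 : 0 < dotv u v / (sqnorm u + 1).
    by rewrite divr_gt0// ltr_pwDr// sqnorm_ge0.
  have := dotv_young _ u v a0; rewrite sv mulr0 addr0.
  suff : dotv u v / (sqnorm u + 1) * sqnorm u <= dotv u v by lra.
  rewrite mulrAC ler_pdivrMr ?ltr_pwDr ?sqnorm_ge0//.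
  by rewrite mulrDr mulr1 lerDl ltW.
have su : sqnorm u = 0 by rewrite -sqr_enorm -u0 expr0n.
rewrite -u0 mul0r leNgt; apply/negP => uv.
have a0 : 0 < dotv v u / (sqnorm v + 1).
  by rewrite dotvC divr_gt0// ltr_pwDr// sqnorm_ge0.
have := dotv_young _ v u a0; rewrite su mulr0 addr0.
suff : dotv v u / (sqnorm v + 1) * sqnorm v <= dotv v u by rewrite (dotvC v); lra.
rewrite mulrAC ler_pdivrMr ?ltr_pwDr ?sqnorm_ge0//.
by rewrite mulrDr mulr1 lerDl dotvC ltW.
Qed.

Lemma enormD u v : enorm (u + v) <= enorm u + enorm v.
Proof.
rewrite -(@ler_pXn2r _ 2) ?nnegrE ?addr_ge0 ?enorm_ge0//.
rewrite sqr_enorm sqnormD sqrrD !sqr_enorm.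
by have := cauchy_schwarz u v; lra.
Qed.

Lemma enormZ a u : 0 <= a -> enorm (a *: u) = a * enorm u.
Proof.
by move=> a0; rewrite /enorm sqnormZ sqrtrM ?sqr_ge0// sqrtr_sqr ger0_norm.
Qed.

Lemma sqnorm_le_sqr K u v : enorm u <= K * enorm v -> sqnorm u <= K ^+ 2 * sqnorm v.
Proof.
move=> uv; rewrite -!sqr_enorm -exprMn lerXn2r// nnegrE ?enorm_ge0//.
by apply: le_trans uv; exact: enorm_ge0.
Qed.

(** The difference of the two sides is the empirical variance of the [F i]. *)
Lemma sqnorm_avg_le (n : nat) (F : 'I_n -> 'rV[R]_d) : (0 < n)%N ->
  sqnorm (n%:R^-1 *: \sum_i F i) <= n%:R^-1 * \sum_i sqnorm (F i).
Proof.
move=> n0; have nR : (0 : R) < n%:R by rewrite ltr0n.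
set m := n%:R^-1 *: _.
have : 0 <= n%:R^-1 * \sum_i sqnorm (F i - m).
  by apply: mulr_ge0; [rewrite invr_ge0 ltW|apply: sumr_ge0 => i _; exact: sqnorm_ge0].
suff -> : n%:R^-1 * \sum_i sqnorm (F i - m)
    = n%:R^-1 * \sum_i sqnorm (F i) - sqnorm m by lra.
under eq_bigr do rewrite sqnormB.
rewrite big_split sumrB /= -mulr_sumr -dotv_suml sumr_const card_ord.
have -> : \sum_i F i = n%:R *: m by rewrite scalerA divff ?gt_eqF// scale1r.
rewrite dotvZl -mulr_natl -/(sqnorm m); field; by rewrite gt_eqF.
Qed.

Lemma sqnormD_young a u v : 0 < a ->
  sqnorm (u + v) <= (1 + a) * sqnorm u + (1 + a^-1) * sqnorm v.
Proof. by move=> /(dotv_young a u v); rewrite sqnormD; lra. Qed.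

End EuclideanVectors.

(** * Convexity, subgradients and existence of proximal points *)

Section ConvexAnalysis.
Context {R : realType} {d : nat}.
Local Notation vec := 'rV[R]_d.
Implicit Types (x y z v p : vec) (g : vec -> \bar R).

(** Convexity bounds the difference quotients for [0 < h <= 1] by [F y - F x], so the directional
    derivative is taken as a limit from the right. *)
Lemma convex_gradient_le (F : vec -> R) gF x y :
  convex_fun F -> is_gradient F gF -> F x + dotv (gF x) (y - x) <= F y.
Proof.
move=> cF /(_ x)[dF gE]; rewrite -gE -deriveE// -lerBrDl /derive.
have := @diff_derivable _ _ _ F x (y - x) dF; rewrite /derivable => cv.
rewrite cvg_at_rightE//; apply: limr_le.
  by apply/cvg_ex; eexists; exact: cvg_dnbhs_at_right cv.
near=> h.
have h0 : 0 < h by near: h; exact: nbhs_right_gt.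
have h1 : h <= 1 by near: h; exact: nbhs_right_le.
have := cF y x h; rewrite (ltW h0) h1 => /(_ isT).
have -> : h *: y + (1 - h) *: x = h *: (y - x) + x.
  by apply/rowP => j; rewrite !mxE; ring.
rewrite /= => hF; rewrite ler_pdivrMl//; rewrite mulrBr; lra.
Unshelve. all: end_near.
Qed.

(** Convexity at [y] and Cauchy-Schwarz replace integration of the gradient along the segment. They
    give [L] where the descent lemma has [L / 2], which the term [2 * L] in the stepsize condition
    allows. *)
Lemma convex_lipschitz_le (F : vec -> R) gF L x y :
  convex_fun F -> is_gradient F gF -> lipschitz_map gF L ->
  F y <= F x + dotv (gF x) (y - x) + L * sqnorm (y - x).
Proof.
move=> cF dF lF; have := convex_gradient_le F gF y x cF dF.
rewrite -opprB dotvNr; set q := y - x.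
have : dotv (gF y - gF x) q <= L * sqnorm q.
  rewrite (le_trans (cauchy_schwarz _ _))// -sqr_enorm expr2 mulrA.
  by rewrite ler_wpM2r ?enorm_ge0// lF.
by rewrite dotvDl dotvNl; lra.
Qed.

Lemma le_of_small_slope (a b c : R) :
  (forall t, 0 < t <= 1 -> a <= b + t * c) -> a <= b.
Proof.
move=> h; apply/ler_addgt0Pr => e e0.
have c0 : 0 < `|c| + 1 by rewrite ltr_pwDr.
pose t := Num.min 1 (e / (`|c| + 1)).
have t0 : 0 < t by rewrite lt_min ltr01 divr_gt0.
have /h/le_trans : 0 < t <= 1 by rewrite t0 ge_min lexx.
apply; rewrite lerD2l (@le_trans _ _ (t * (`|c| + 1)))//.
  by rewrite ler_pM2l// (le_trans (ler_norm c))// lerDl.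
by rewrite -ler_pdivlMr// ge_min lexx orbT.
Qed.

(** Fermat's rule from a quadratic upper model of [phi] at [y]: compare [y] with [y + t (z - y)],
    divide by [t] and let [t] tend to 0. *)
Lemma subdiff_of_min (phi : vec -> R) g y p (K : R) :
  convex_ext g -> g y \is a fin_num ->
  (forall z, phi z <= phi y + dotv p (z - y) + K * sqnorm (z - y)) ->
  (forall z, (phi y)%:E + g y <= (phi z)%:E + g z)%E ->
  subdiff g y (- p).
Proof.
move=> cg /fineK; move: (fine _) => gy gyE phiP miny z; rewrite -gyE.
case gzE : (g z) => [gz| |]; last 2 first.
- exact: leey.
- by have := miny z; rewrite gzE -gyE.
rewrite -EFinD lee_fin; apply: (@le_of_small_slope _ _ (K * sqnorm (z - y))) => t.
move=> /[dup] /andP[t0 t1] /andP[/ltW t0' _].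
have zE : t *: z + (1 - t) *: y = y + t *: (z - y).
  by apply/rowP => j; rewrite !mxE; ring.
have := cg z y t; rewrite t0' t1 => /(_ isT); rewrite zE gzE -gyE => h1.
have := le_trans (miny _) (leeD2l _ h1); rewrite -gyE !(=^~EFinM, =^~EFinD) lee_fin.
have := phiP (y + t *: (z - y)); rewrite [_ + t *: _ - y]addrC addKr.
rewrite sqnormZ dotvZr dotvNl => h2 h3.
rewrite -(ler_pM2l t0); rewrite expr2 in h2; lra.
Qed.

Lemma sqnormB_continuous v : continuous (fun z : vec => sqnorm (v - z)).
Proof.
rewrite /sqnorm /dotv; apply: continuous_big => [|j _ z]; first exact: add_continuous.
under eq_fun do rewrite !mxE.
rewrite /continuous_at; have h : (v ord0 j - x ord0 j) @[x --> z] --> v ord0 j - z ord0 j.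
  by apply: cvgB; [exact: cvg_cst|exact: coord_continuous].
by apply: (cvgM h h).
Qed.

Lemma coord_le_sqnorm v j : `|v ord0 j| <= sqnorm v + 1.
Proof.
have : `|v ord0 j| ^+ 2 <= sqnorm v.
  rewrite /sqnorm /dotv (bigD1 j)//= real_normK ?num_real// expr2 lerDl.
  by apply: sumr_ge0 => k _; rewrite -expr2 sqr_ge0.
have := sqr_ge0 (`|v ord0 j| - 1); rewrite sqrrB1; nra.
Qed.

(** Weierstrass' theorem on the epigraph of [g], where the objective [gamma r + |v - z|^2 / 2] is
    continuous although [g] need not be. The affine minorant of [g] bounds the sublevel sets. *)
Lemma prox_exists g (gamma c : R) p v : 0 < gamma ->
  closed_ext g -> proper_ext g ->
  (forall z, (c + dotv p z)%:E <= g z)%E ->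
  exists y, forall z, (gamma%:E * g y + (sqnorm (v - y) / 2)%:E
                        <= gamma%:E * g z + (sqnorm (v - z) / 2)%:E)%E.
Proof.
move=> g0 clg [_ [z0 /fineK]]; move: (fine _) => t0 /esym gz0 low.
(* [l0] is the objective at [(z0, t0)]. On its sublevel set, [M] bounds [|v - z|^2 / 4], [N] bounds
   [|z|^2], and [B] bounds [r] and every coordinate of [z] in absolute value. *)
pose l0 := gamma * t0 + sqnorm (v - z0) / 2.
pose M := l0 - gamma * c - gamma * dotv p v + gamma ^+ 2 * sqnorm p.
pose N := 2 * sqnorm v + 8 * M.
pose B := N + 1 + `|l0 / gamma| + `|c| + sqnorm p.
have inB z r : g z = r%:E -> gamma * r + sqnorm (v - z) / 2 <= l0 ->
    (forall j, - B <= z ord0 j <= B) /\ - B <= r <= B.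
  move=> gz hr; have := low z; rewrite gz lee_fin => lowr.
  have q1 : sqnorm (v - z) / 4 <= M.
    have := dotv_young 2 (gamma *: p) (v - z) ltac:(lra).
    rewrite sqnormZ dotvZl dotvDr dotvNr /M => yg.
    have := ler_wpM2l (ltW g0) lowr; lra.
  have N1 : sqnorm z <= N.
    have := sqnormD_young 1 (v - z) (- v) ltr01.
    rewrite addrAC subrr add0r !sqnormN.
    by rewrite invr1 /N; lra.
  have n1 := ler_norm (l0 / gamma); have n2 := ler_norm (- c).
  rewrite normrN in n2.
  have n3 := normr_ge0 (l0 / gamma); have n4 := normr_ge0 c.
  have s1 := sqnorm_ge0 p; have s2 := sqnorm_ge0 z.
  split.
    move=> j; have := coord_le_sqnorm z j; rewrite ler_norml => /andP[].
    by rewrite /B => ? ?; apply/andP; split; lra.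
  have r1 : r <= l0 / gamma.
    by rewrite ler_pdivlMr//; have := sqnorm_ge0 (v - z); lra.
  have := dotv_young 1 (- p) z ltr01.
  rewrite dotvNl invr1 sqnormN => yg.
  by rewrite /B; apply/andP; split; lra.
pose I : set R := [set` `[- B, B]].
pose box : set (vec * R) := [set w : vec | forall j, I (w ord0 j)] `*` I.
pose K := [set q : vec * R | (g q.1 <= q.2%:E)%E] `&` box.
have cK : compact K.
  rewrite /K setIC; apply: compact_closedI.
    apply: compact_setX; last exact: segment_compact.
    by apply: (@rV_compact _ _ (fun=> I)) => _; exact: segment_compact.
  exact: clg.
have KP z r : g z = r%:E -> gamma * r + sqnorm (v - z) / 2 <= l0 -> K (z, r).
  move=> gz /(inB _ _ gz)[hz hr]; split; first by rewrite /= gz.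
  by split => [j|]; rewrite /I /= in_itv /=.
have K0 : K !=set0 by exists (z0, t0); exact: KP.
pose Phi (q : vec * R) := gamma * q.2 + sqnorm (v - q.1) / 2.
have cPhi : continuous Phi.
  have c1 : continuous ((fun z : vec => sqnorm (v - z)) \o (fst : vec * R -> vec)).
    move=> q; apply: continuous_comp; first exact: cvg_fst.
    exact: sqnormB_continuous.
  move=> q; apply: cvgD; first by apply: cvgM; [exact: cvg_cst|exact: cvg_snd].
  by apply: cvgM; [exact: c1|exact: cvg_cst].
have [[y s] /set_mem[/= gys _] minq] :=
  compact_EVT_min K0 cK (continuous_subspaceT cPhi).
have ley : (gamma%:E * g y + (sqnorm (v - y) / 2)%:E <= (Phi (y, s))%:E)%E.
  by rewrite /Phi EFinD leeD2r// EFinM lee_wpmul2l// lee_fin ltW.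
exists y => z; apply: (le_trans ley).
case gzE : (g z) => [r| |]; last 2 first.
- by rewrite gt0_muley ?lte_fin// addye// leey.
- by have := low z; rewrite gzE.
rewrite -EFinM -EFinD lee_fin.
(* Points of value at most [l0] lie in [K]; all others lose to [(z0, t0)]. *)
have [hr|/ltW hr] := leP (gamma * r + sqnorm (v - z) / 2) l0.
  by apply: (minq (z, r)); rewrite inE; exact: KP.
by apply: le_trans hr; apply: (minq (z0, t0)); rewrite inE; exact: KP.
Qed.

End ConvexAnalysis.

(** * Optimality conditions for proximal points *)

Section ProximalStep.
Context {R : realType} {d : nat}.
Local Notation vec := 'rV[R]_d.
Implicit Types (x y z v p : vec) (g : vec -> \bar R).

(** The term [F] lets one statement cover the resolvent of [F + g] and, for [F = 0], the proximal
    map of [g]. *)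
Lemma prox_subdiff g (F : vec -> R) (gamma K : R) q v y : 0 < gamma ->
  proper_ext g -> convex_ext g ->
  (forall z, F z <= F y + dotv q (z - y) + K * sqnorm (z - y)) ->
  (forall z, gamma%:E * ((F y)%:E + g y) + (sqnorm (v - y) / 2)%:E
          <= gamma%:E * ((F z)%:E + g z) + (sqnorm (v - z) / 2)%:E)%E ->
  g y \is a fin_num /\ subdiff g y (gamma^-1 *: (v - y) - q).
Proof.
move=> g0 [gNy [z1 /fineK]]; move: (fine _) => r1 gz1 cg FP miny.
have gy : g y \is a fin_num.
  rewrite fin_numE gNy /=; apply/eqP => gyE; have := miny z1.
  by rewrite gyE -gz1 addeC /= gt0_muley ?lte_fin// addye.
split=> //; have -> : gamma^-1 *: (v - y) - q = - (q - gamma^-1 *: (v - y)).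
  by rewrite opprB.
pose phi z := F z + (2 * gamma)^-1 * sqnorm (v - z).
apply: (@subdiff_of_min _ _ phi _ _ _ (K + (2 * gamma)^-1)) => // z.
  rewrite /phi; have -> : v - z = (v - y) - (z - y).
    by apply/rowP => j; rewrite !mxE; ring.
  rewrite (sqnormB (v - y)) (dotvDl q) dotvNl dotvZl; have := FP z.
  rewrite invfM; set D := dotv (v - y) _; lra.
have := miny z; move: gy => /fineK; move: (fine _) => ry <-.
case gzE : (g z) => [rz| |]; last 2 first.
- by rewrite addeC /= leey.
- by have := gNy z; rewrite gzE.
rewrite !(=^~EFinM, =^~EFinD) !lee_fin /phi => h.
rewrite -(ler_pM2l g0); move: h; rewrite !mulrDr !mulrA.
have -> : gamma * (2 * gamma)^-1 = 2^-1 by field; rewrite gt_eqF.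
lra.
Qed.

(** A minimizer exists, so [xget] in [prox] does not fall back on its default 0. *)
Lemma prox_is_min g (gamma c : R) p v : 0 < gamma ->
  closed_ext g -> proper_ext g ->
  (forall z, (c + dotv p z)%:E <= g z)%E ->
  forall z, (gamma%:E * g (prox gamma g v) + (sqnorm (v - prox gamma g v) / 2)%:E
                        <= gamma%:E * g z + (sqnorm (v - z) / 2)%:E)%E.
Proof.
by move=> g0 clg pg low; have := xgetPex 0 (prox_exists g gamma c p v g0 clg pg low).
Qed.

(** The epigraph of [F + g] is the preimage of that of [g] under the continuous shear [k]. *)
Lemma closed_extD (F : vec -> R) g : continuous F -> closed_ext g ->
  closed_ext (fun z => (F z)%:E + g z)%E.
Proof.
move=> cF clg; rewrite /closed_ext.
pose k (q : vec * R) : vec * R := (q.1, q.2 - F q.1).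
have -> : [set q : vec * R | ((F q.1)%:E + g q.1 <= q.2%:E)%E]
    = k @^-1` [set q | (g q.1 <= q.2%:E)%E].
  apply/seteqP; split=> -[z t] /=; by rewrite EFinB leeBrDl.
apply: (closed_comp _ clg) => q _.
have c1 : continuous (F \o (fst : vec * R -> vec)).
  by move=> w; apply: continuous_comp; [exact: cvg_fst|exact: cF].
apply: (@cvg_pair _ _ _ _ (nbhs q.1) (nbhs (q.2 - F q.1)) _ _ _ fst (fun w => w.2 - F w.1)).
  exact: cvg_fst.
by apply: cvgB; [exact: cvg_snd|exact: c1].
Qed.

(** * Gap estimates under the Kurdyka-Lojasiewicz inequality *)

Section CompositeProblem.
Variables (F : vec -> R) (gF : vec -> vec) (L : R) (g : vec -> \bar R).
Variables (xs : vec) (rs mu : R).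
Hypotheses (cF : convex_fun F) (dF : is_gradient F gF) (lF : lipschitz_map gF L).
Hypotheses (pg : proper_ext g) (cg : convex_ext g) (clg : closed_ext g).
Hypotheses (minF : is_minimizer F g xs) (gxs : g xs = rs%:E).
Hypotheses (mu0 : 0 < mu) (KL : KL_half F gF g xs mu).

(** [rx] stands for the finite value of [g x], which keeps gaps real. *)
Let gap x rx := F x + rx - F xs - rs.

Lemma gap_ge0 x rx : g x = rx%:E -> 0 <= gap x rx.
Proof. by move=> gx; have := minF x; rewrite gx gxs -!EFinD lee_fin /gap; lra. Qed.

(** [y] minimizes [F + g + |x - .|^2 / (2 gamma)], so [(x - y) / gamma - gF y] is a subgradient of
    [g] at [y]. KL at [y] gives the first bound, convexity tested at [x] the second, minimality the
    third. *)
Lemma resolvent_step x rx gamma : 0 < gamma -> g x = rx%:E ->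
  exists y ry, let s := sqnorm (x - y) / (2 * gamma) in
   [/\ g y = ry%:E, gamma * mu * gap y ry <= s, gap y ry + 2 * s <= gap x rx &
       forall z rz, g z = rz%:E -> gap y ry + s <= gap z rz + sqnorm (x - z) / (2 * gamma)].
Proof.
move=> g0 gx.
have cont : continuous F by move=> z; apply: differentiable_continuous; have [] := dF z.
have [z1 /fineK] := pg.2; move: (fine _) => r1 gz1.
have pF : proper_ext (fun z => (F z)%:E + g z)%E.
  split; last by exists z1; rewrite -gz1.
  by move=> z; have := pg.1 z; case: (g z).
have low z : ((F xs + rs + dotv 0 z)%:E <= (F z)%:E + g z)%E.
  by rewrite dot0v addr0 EFinD -gxs; exact: minF.
have [y miny] := prox_exists _ _ _ _ x g0 (closed_extD _ _ cont clg) pF low.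
have up z : F z <= F y + dotv (gF y) (z - y) + L * sqnorm (z - y).
  exact: convex_lipschitz_le.
have [/fineK] := prox_subdiff _ _ _ _ _ _ _ g0 pg cg up miny.
move: (fine _) => ry /esym gy sub.
exists y, ry => /=; split => //.
- have := KL y _ sub; rewrite [gF y + _]addrC subrK gy gxs.
  rewrite !(=^~EFinM, =^~EFinD, =^~EFinB) lee_fin sqnormZ -/(gap y ry) => h.
  have -> : sqnorm (x - y) / (2 * gamma) = gamma / 2 * (gamma^-1 ^+ 2 * sqnorm (x - y)).
    by field; rewrite gt_eqF.
  have -> : gamma * mu * gap y ry = gamma / 2 * (2 * mu * gap y ry) by field.
  by rewrite ler_pM2l ?divr_gt0.
- have := sub x; rewrite gx gy -EFinD lee_fin dotvDl dotvNl dotvZl.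
  have := convex_gradient_le F gF y x cF dF.
  have -> : 2 * (sqnorm (x - y) / (2 * gamma)) = gamma^-1 * dotv (x - y) (x - y).
    by rewrite -/(sqnorm _); field; rewrite gt_eqF.
  by rewrite /gap; lra.
- move=> z rz gz; have := miny z; rewrite gy gz !(=^~EFinM, =^~EFinD) lee_fin => h.
  rewrite -(ler_pM2l g0) !mulrDr /gap.
  have E w : gamma * (sqnorm w / (2 * gamma)) = sqnorm w / 2.
    by field; rewrite gt_eqF.
  by rewrite !E; move: h; lra.
Qed.

(* A Gronwall-type estimate for the Moreau envelope: doubling the parameter
   costs nothing because only half of the KL rate is claimed. *)
Lemma moreau_envelope_decay k : forall x rx gamma,
  0 < gamma -> gamma * mu <= 2 ^+ k -> g x = rx%:E ->
  exists y ry, g y = ry%:E /\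
    gap y ry + sqnorm (x - y) / (2 * gamma) <= gap x rx / (1 + gamma * mu / 2).
Proof.
elim: k => [|k IH] x rx gamma g0 gmu gx.
  have m0 : 0 < gamma * mu by exact: mulr_gt0.
  have [y [ry /= [gy h1 h2 _]]] := resolvent_step x rx gamma g0 gx.
  exists y, ry; split=> //; rewrite ler_pdivlMr; last by lra.
  have := gap_ge0 _ _ gy; move: m0 h1 h2 gmu; rewrite expr0.
  set s := _ / _; move: s (gap y ry) (gap x rx) (gamma * mu) => s a b m m0 h1 h2 m1 a0.
  have s0 : 0 <= s by apply: le_trans h1; rewrite mulr_ge0// ltW.
  have : m * s <= s by rewrite ler_piMl.
  by lra.
have h0 : 0 < gamma / 2 by rewrite divr_gt0.
have m0 : 0 < gamma * mu by exact: mulr_gt0.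
have hmu : gamma / 2 * mu <= 2 ^+ k by move: gmu; rewrite exprS; lra.
have [z [rz [gz hz]]] := IH x rx _ h0 hmu gx.
have [y [ry /= [gy h1 _ /(_ z rz gz) h2]]] := resolvent_step x rx _ h0 gx.
exists y, ry; split=> //; move: (le_trans h2 hz).
have -> : sqnorm (x - y) / (2 * gamma) = sqnorm (x - y) / (2 * (gamma / 2)) / 2.
  by field; rewrite gt_eqF.
(* [(a + s)(1 + m / 4)] exceeds [(a + s / 2)(1 + m / 2)] by [s / 2 - a m / 4], which is nonnegative
   by KL at [y], that is [m / 2 * a <= s]. *)
rewrite !ler_pdivlMr; [|lra..]; move: m0 h1; rewrite (mulrAC gamma).
set s := sqnorm _ / _; move: s (gap y ry) (gap x rx) (gamma * mu) => s a b m.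
by lra.
Qed.

(** Combines the subgradient inequality of [g] at [x'] tested at [y], convexity and smoothness of
    [F] at [x], and Young's inequality for [dotv (gF x - v) (x' - y)]. The term in [|x' - y|^2] of
    the latter cancels against that of the proximal step. *)
Lemma inexact_prox_gradient_step gamma x rx v :
  0 < gamma -> g x = rx%:E ->
  let x' := prox gamma g (x - gamma *: v) in
  exists r', g x' = r'%:E /\
    gap x' r' + (1 - 2 * gamma * L) / (2 * gamma) * sqnorm (x' - x)
    <= gap x rx / (1 + gamma * mu / 2) + gamma / 2 * sqnorm (gF x - v).
Proof.
move=> g0 gx x'.
have up z y : F z <= F y + dotv (gF y) (z - y) + L * sqnorm (z - y).
  exact: convex_lipschitz_le.
(* The minimizer supplies the affine minorant of [g] on which existence of the proximal point
   rests. *)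
have sub_xs : subdiff g xs (- gF xs).
  apply: (subdiff_of_min F _ _ _ L cg) => //.
  by rewrite gxs.
have low z : ((rs + dotv (gF xs) xs + dotv (- gF xs) z)%:E <= g z)%E.
  by apply: le_trans (sub_xs z); rewrite gxs -EFinD lee_fin !dotvE; lra.
have minx' := prox_is_min _ _ _ _ (x - gamma *: v) g0 clg pg low.
have up0 z : (0 : R) <= 0 + dotv 0 (z - x') + 0 * sqnorm (z - x').
  by rewrite dot0v mul0r !addr0.
have min0 z : (gamma%:E * (0%:E + g x') + (sqnorm (x - gamma *: v - x') / 2)%:E
    <= gamma%:E * (0%:E + g z) + (sqnorm (x - gamma *: v - z) / 2)%:E)%E.
  by rewrite !add0e; exact: minx'.
have [/fineK] := prox_subdiff _ (fun=> 0) _ 0 _ _ _ g0 pg cg up0 min0.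
move: (fine _) => r' /esym gx'; rewrite subr0 => sub; exists r'; split=> //.
(* [k] halvings bring the parameter down to the base case of the envelope estimate. *)
have [k kmu] : exists k, gamma * mu <= 2 ^+ k.
  exists (Num.bound (gamma * mu)); apply: ltW.
  apply: lt_le_trans (archi_boundP _) _; first by rewrite ltW ?mulr_gt0.
  by rewrite -natrX ler_nat ltnW// ltn_expl.
have [y [ry [gy hy]]] := moreau_envelope_decay k x rx gamma g0 kmu gx.
apply: le_trans (lerD hy (lexx _)).
have := sub y; rewrite gx' gy -EFinD lee_fin.
have := convex_gradient_le F gF x y cF dF; have := up x' x.
have := dotv_young gamma (gF x - v) (x' - y) g0.
set b := x' - x; pose e := x - y.
have -> : y - x = - e by rewrite opprB.
have -> : x' - y = b + e by rewrite addrA subrK.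
have -> : y - x' = - (b + e) by rewrite /b /e addrA subrK opprB.
have -> : x - gamma *: v - x' = - b - gamma *: v.
  by rewrite /b opprB addrAC.
rewrite -/e; clearbody b e; rewrite !sqnormD dotvZl !dotvE -!/(sqnorm _) => h1 h2 h3 h4.
rewrite /gap; have E t : t / (2 * gamma) = gamma^-1 * t / 2.
  by field; rewrite gt_eqF.
have E2 : (1 - 2 * gamma * L) / (2 * gamma) = gamma^-1 / 2 - L.
  by field; rewrite gt_eqF.
have E3 t : gamma^-1 * (gamma * t) = t by rewrite mulrA mulVf ?gt_eqF// mul1r.
rewrite E2 E; rewrite !(mulrDr, mulrN, mulrBr, E3, opprD, opprK) in h1 h4 *.
rewrite ?(dotvC e b) in h1 h2 h3 h4 *.
lra.
Qed.

End CompositeProblem.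
End ProximalStep.

(** * Mean bounds for squared norms of random vectors *)

Section MeanBounds.
Context {R : realType} {dT : measure_display} {T : measurableType dT}.
Variable P : probability T R.
Local Open Scope ereal_scope.

(* The integral of a nonnegative function is a lower integral, so it is monotone
   even when the functions are not measurable. *)
Lemma ge0_le_lower_integral (F G : T -> \bar R) :
  (forall s, 0 <= F s <= G s) -> \int[P]_s F s <= \int[P]_s G s.
Proof.
move=> FG; have F0 s : 0 <= F s by have /andP[] := FG s.
have G0 s : 0 <= G s by have /andP[h1 h2] := FG s; exact: le_trans h2.
rewrite !ge0_integralTE//; apply: ereal_sup_le => _ [h hF <-].
by exists h => // s; apply: le_trans (hF s) _; have /andP[] := FG s.
Qed.

Local Open Scope ring_scope.

(** Bundles what additivity of the integral of nonnegative functions asks for, so that bounds on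
    means can be added and scaled. *)
Definition mean_le (X : T -> R) (v : R) :=
  [/\ measurable_fun setT X, forall s, 0 <= X s
    & (\int[P]_s (X s)%:E <= v%:E)%E].

Lemma mean_le_cst (a : R) : 0 <= a -> mean_le (fun=> a) a.
Proof.
move=> a0; split => //.
by rewrite integral_cst//= probability_setT mule1.
Qed.

Lemma mean_leD X Y a b : mean_le X a -> mean_le Y b ->
  mean_le (fun s => X s + Y s) (a + b).
Proof.
move=> [mX X0 hX] [mY Y0 hY]; split; [exact: measurable_funD| |].
  by move=> s; rewrite addr_ge0.
under eq_integral do rewrite EFinD.
rewrite ge0_integralD//; first by rewrite EFinD leeD.
- by move=> s _; rewrite lee_fin.
- exact/measurable_EFinP.
- by move=> s _; rewrite lee_fin.
- exact/measurable_EFinP.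
Qed.

Lemma mean_leZ (k : R) X a : 0 <= k -> mean_le X a ->
  mean_le (fun s => k * X s) (k * a).
Proof.
move=> k0 [mX X0 hX]; split; [exact: measurable_funM| |].
  by move=> s; rewrite mulr_ge0.
under eq_integral do rewrite EFinM.
rewrite ge0_integralZl_EFin//; first by rewrite EFinM lee_wpmul2l// lee_fin.
- by move=> s _; rewrite lee_fin.
- exact/measurable_EFinP.
Qed.

Lemma mean_le_sum (I : finType) (X : I -> T -> R) a :
  (forall i, mean_le (X i) (a i)) -> mean_le (fun s => \sum_i X i s) (\sum_i a i).
Proof.
move=> h; elim: (index_enum I) => [|i r IH].
  rewrite big_nil; under eq_fun do rewrite big_nil; exact: mean_le_cst.
by rewrite big_cons; under eq_fun do rewrite big_cons; exact: mean_leD.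
Qed.

Lemma mean_le_weaken X a b : a <= b -> mean_le X a -> mean_le X b.
Proof. by move=> ab [? ? h]; split => //; rewrite (le_trans h)// lee_fin. Qed.

Context {d : nat}.

Definition centered (Z : T -> 'rV[R]_d) := forall j,
  P.-integrable setT (fun s => (Z s ord0 j)%:E) /\ (\int[P]_s (Z s ord0 j)%:E = 0)%E.

Lemma centered_sub_mean (X : T -> 'rV[R]_d) :
  (forall j, P.-integrable setT (fun s => (X s ord0 j)%:E)) ->
  centered (fun s => X s - Evec P X).
Proof.
move=> iX j; under eq_fun do rewrite !mxE EFinB.
have ic := @finite_measure_integrable_cst _ T R P setT
  (Rintegral P setT (fun s => X s ord0 j)) measurableT.
split; first exact: integrableB.
rewrite integralB//= integral_cst//= probability_setT mule1.
by rewrite /Rintegral fineK ?subee// integrable_fin_num.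
Qed.

Lemma centeredZ (k : R) Z : centered Z -> centered (fun s => k *: Z s).
Proof.
move=> cZ j; have [iZ Z0] := cZ j.
under eq_fun do rewrite !mxE EFinM.
split; first exact: integrableZl.
by rewrite integralZl// Z0 mule0.
Qed.

Lemma centered_sum (I : finType) (Z : I -> T -> 'rV[R]_d) :
  (forall i, centered (Z i)) -> centered (fun s => \sum_i Z i s).
Proof.
move=> cZ j; have iZ i := (cZ i j).1.
under eq_fun do rewrite summxE -sumEFin.
split; first exact: integrable_sum.
by rewrite integral_sum// big1// => i _; have [] := cZ i j.
Qed.

(** Bias-variance decomposition: the cross term [2 k dotv m (Z s)] has mean 0, and the bound [V]
    makes [sqnorm (Z s)] integrable, so the integral splits. *)
Lemma mean_sqnorm_shift_le (m : 'rV[R]_d) (k V : R) Z : centered Z ->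
  (\int[P]_s (sqnorm (Z s))%:E <= V%:E)%E ->
  mean_le (fun s => sqnorm (m + k *: Z s)) (sqnorm m + k ^+ 2 * V).
Proof.
move=> cZ hV.
have mZ j : measurable_fun setT (fun s => Z s ord0 j).
  by apply/measurable_EFinP; exact: measurable_int (cZ j).1.
have mN : measurable_fun setT (fun s => sqnorm (Z s)).
  by apply: measurable_sum => j; exact: measurable_funM.
have iN : P.-integrable setT (fun s => (sqnorm (Z s))%:E).
  apply/integrableP; split; first exact/measurable_EFinP.
  under eq_integral do rewrite gee0_abs ?lee_fin ?sqnorm_ge0//.
  by apply: le_lt_trans hV _; rewrite ltry.
have [iD D0] : P.-integrable setT (fun s => (dotv m (Z s))%:E) /\
    (\int[P]_s (dotv m (Z s))%:E = 0)%E.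
  have iM j : P.-integrable setT (fun s => ((m ord0 j)%:E * (Z s ord0 j)%:E)%E).
    by apply: integrableZl => //; exact: (cZ j).1.
  have E s : (dotv m (Z s))%:E = (\sum_j (m ord0 j)%:E * (Z s ord0 j)%:E)%E.
    by rewrite -sumEFin.
  under eq_fun do rewrite E.
  split; first exact: integrable_sum.
  rewrite integral_sum// big1// => j _.
  by rewrite integralZl//; [rewrite (cZ j).2 mule0|exact: (cZ j).1].
have E s : sqnorm (m + k *: Z s)
    = sqnorm m + (2 * k * dotv m (Z s) + k ^+ 2 * sqnorm (Z s)).
  by rewrite sqnormD dotvZr sqnormZ; ring.
have mD : measurable_fun setT (fun s => dotv m (Z s)).
  by apply/measurable_EFinP; exact: measurable_int iD.
split.
- under eq_fun do rewrite E.
  by do !apply: measurable_funD => //; apply: measurable_funM.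
- by move=> s; exact: sqnorm_ge0.
have ic := @finite_measure_integrable_cst _ T R P setT (sqnorm m) measurableT.
have i1 : P.-integrable setT (fun s => ((2 * k)%:E * (dotv m (Z s))%:E)%E).
  exact: integrableZl.
have i2 : P.-integrable setT (fun s => ((k ^+ 2)%:E * (sqnorm (Z s))%:E)%E).
  exact: integrableZl.
under eq_integral do rewrite E EFinD EFinD (EFinM (2 * k)) (EFinM (k ^+ 2)).
rewrite integralD//; last exact: integrableD.
rewrite integralD// !integralZl// D0 mule0 add0e.
rewrite integral_cst//= probability_setT mule1 EFinD (EFinM (k ^+ 2) V) leeD2l//.
by rewrite lee_wpmul2l// lee_fin sqr_ge0.
Qed.

End MeanBounds.

(** * Convexity and gradient of the averaged function *)

Section Averages.
Context {R : realType} {d n : nat}.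
Local Notation vec := 'rV[R]_d.
Implicit Types (f : 'I_n -> vec -> R) (gradf : 'I_n -> vec -> vec).

Lemma favg_convex f : (forall i, convex_fun (f i)) -> convex_fun (favg f).
Proof.
move=> cf x y a a01; rewrite /favg !mulr_sumr -big_split /=.
apply: ler_sum => i _; rewrite mulrCA (mulrCA (1 - a)) -mulrDr ler_wpM2l//.
exact: cf.
Qed.

Lemma favg_gradient f gradf : (forall i, is_gradient (f i) (gradf i)) ->
  is_gradient (favg f) (gavg gradf).
Proof.
move=> gf x.
have ds (s : seq 'I_n) : is_diff x (fun y => \sum_(i <- s) f i y)
    (fun v => \sum_(i <- s) dotv (gradf i x) v).
  elim: s => [|i s IH].
    by under eq_fun do rewrite big_nil; under [X in is_diff _ _ X]eq_fun do rewrite big_nil;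
       exact: is_diff_cst.
  under eq_fun do rewrite big_cons; under [X in is_diff _ _ X]eq_fun do rewrite big_cons.
  have [df dE] := gf i x; have di : is_diff x (f i) (dotv (gradf i x)).
    by apply: DiffDef => //; apply/funext => v; rewrite dE.
  exact: is_diffD.
have dF : is_diff x (n%:R^-1 *: (fun y => \sum_(i <- index_enum 'I_n) f i y))
    (n%:R^-1 *: (fun v => \sum_(i <- index_enum 'I_n) dotv (gradf i x) v)).
  by have := ds (index_enum _); exact: is_diffZ.
have FE : favg f = n%:R^-1 *: (fun y => \sum_(i <- index_enum 'I_n) f i y) by [].
rewrite FE; split; first exact: ex_diff.
by move=> v; rewrite diff_val /gavg dotvZl dotv_suml.
Qed.

End Averages.

(** * Bias and variance of compressed vectors *)

Section CompressionError.
Context {R : realType} {d : nat} {dT : measure_display} {T : measurableType dT}.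
Local Notation vec := 'rV[R]_d.
Variables (P : probability T R) (eta : R).

(** The vector is [(1 - a) w] minus [a] times the bias of the compressor at [w], whose norm is at
    most [eta * enorm w]. *)
Lemma compressor_bias_le (a om : R) (C : T -> vec -> vec) w : 0 <= a <= 1 ->
  compressor_class P C eta om ->
  sqnorm (w - a *: Evec P (fun s => C s w)) <= (1 - a + a * eta) ^+ 2 * sqnorm w.
Proof.
move=> /andP[a0 a1] [_ [+ _]] => /(_ w); set E := Evec _ _ => h.
apply: sqnorm_le_sqr.
have -> : w - a *: E = (1 - a) *: w + a *: - (E - w).
  by apply/rowP => j; rewrite !mxE; ring.
rewrite (le_trans (enormD _ _))// !enormZ ?subr_ge0//.
rewrite enormN (mulrDl (1 - a)) lerD2l -mulrA.
exact: ler_wpM2l.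
Qed.

Lemma control_variate_error_le (lam om : R) (C : T -> vec -> vec) w :
  0 <= lam <= 1 -> compressor_class P C eta om ->
  mean_le P (fun s => sqnorm (w - lam *: C s w)) (rconst lam eta om * sqnorm w).
Proof.
move=> lam01 cC; have b := compressor_bias_le lam om C w lam01 cC.
have [iC [_ /(_ w) vC]] := cC.
have cZ := centered_sub_mean P _ (iC w).
have := mean_sqnorm_shift_le P (w - lam *: Evec P (fun s => C s w)) (- lam) _ _ cZ vC.
set E := Evec _ _.
have -> : (fun s => sqnorm (w - lam *: E + - lam *: (C s w - E)))
    = (fun s => sqnorm (w - lam *: C s w)).
  by apply/funext => s; congr sqnorm; apply/rowP => j; rewrite !mxE; ring.
by apply: mean_le_weaken; rewrite /rconst sqrrN mulrDl mulrA lerD2r.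
Qed.

(** The squared bias of the average is at most the average of the individual ones; the variance of
    the average is controlled by [omav] directly. *)
Lemma gradient_estimate_error_le (n : nat) (nu om omav : R)
    (C : 'I_n -> T -> vec -> vec) (w : 'I_n -> vec) :
  (0 < n)%N -> 0 <= nu <= 1 -> (forall i, compressor_class P (C i) eta om) ->
  omega_av_bound P C omav ->
  mean_le P (fun s => sqnorm (n%:R^-1 *: \sum_i (w i - nu *: C i s (w i))))
    (rconst nu eta omav * (n%:R^-1 * \sum_i sqnorm (w i))).
Proof.
move=> n0 nu01 cC /(_ w) vC.
pose E i := Evec P (fun s => C i s (w i)).
have cZ : centered P (fun s => n%:R^-1 *: \sum_i (C i s (w i) - E i)).
  apply: centeredZ; apply: centered_sum => i; apply: centered_sub_mean.
  by have [+ _] := cC i; exact.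
have := mean_sqnorm_shift_le P (n%:R^-1 *: \sum_i (w i - nu *: E i)) (- nu) _ _ cZ vC.
have -> : (fun s => sqnorm (n%:R^-1 *: (\sum_i (w i - nu *: E i))
                + - nu *: (n%:R^-1 *: \sum_i (C i s (w i) - E i))))
    = (fun s => sqnorm (n%:R^-1 *: \sum_i (w i - nu *: C i s (w i)))).
  apply/funext => s; congr sqnorm.
  rewrite scalerA mulrC -scalerA -scalerDr scaler_sumr -big_split /=.
  congr (_ *: _); apply: eq_bigr => i _.
  by apply/rowP => j; rewrite !mxE; ring.
apply: mean_le_weaken.
have := sqnorm_avg_le n (fun i => w i - nu *: E i) n0.
have : n%:R^-1 * \sum_i sqnorm (w i - nu *: E i)
    <= n%:R^-1 * \sum_i (1 - nu + nu * eta) ^+ 2 * sqnorm (w i).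
  rewrite ler_wpM2l ?invr_ge0// ler_sum// => i _.
  exact: compressor_bias_le nu01 (cC i).
rewrite -mulr_sumr /rconst sqrrN => h1 h2.
apply: le_trans (lerD (le_trans h2 h1) (lexx _)) _.
by rewrite le_eqVlt; apply/orP; left; apply/eqP; ring.
Qed.

End CompressionError.

(** * The constant [sstar] and the stepsize condition *)

Section Stepsize.
Context {R : realType}.
Implicit Types r rav gamma L Lt : R.

Lemma sstar_gt0 r : 0 < r < 1 -> 0 < sstar r.
Proof.
move=> /andP[r0 r1]; rewrite subr_gt0 -[ltLHS]sqrtr1 ltr_sqrt ?ltr_pdivlMr; lra.
Qed.

(** This choice of [sstar] keeps half of the margin [1 - r] after the Young factors are paid. *)
Lemma sstar_rate r : 0 < r < 1 -> (1 + sstar r) ^+ 2 * r = (1 + r) / 2.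
Proof.
move=> /andP[r0 r1]; rewrite /sstar addrC subrK sqr_sqrtr; last first.
  by rewrite divr_ge0; lra.
by field; rewrite gt_eqF.
Qed.

(** Multiplied by [2 gamma], the left side is [(gamma A)^2] with [A = Lt sqrt(rav / r) / sstar r].
    As [gamma A <= 1 - 2 gamma L <= 1], its square is at most [1 - 2 gamma L]. *)
Lemma stepsize_absorbs_drift r rav gamma L Lt : 0 < r < 1 -> 0 < rav ->
  0 < gamma -> 0 <= L -> 0 <= Lt ->
  gamma * (2 * L + Lt * Num.sqrt (rav / r) * (sstar r)^-1) <= 1 ->
  gamma / (2 * thetastar r rav) * (1 + (sstar r)^-1) * Lt ^+ 2
    <= (1 - 2 * gamma * L) / (2 * gamma).
Proof.
move=> r01 rav0 g0 L0 Lt0; have S0 := sstar_gt0 r r01; have /andP[r0 r1] := r01.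
set S := sstar r in S0 *; set A := Lt * _ * _ => hg.
have A0 : 0 <= A by rewrite /A !mulr_ge0 ?sqrtr_ge0 ?invr_ge0// ltW.
have A2 : A ^+ 2 = Lt ^+ 2 * (rav / r) / S ^+ 2.
  by rewrite /A !exprMn sqr_sqrtr ?exprVn// divr_ge0// ltW.
rewrite ler_pdivlMr ?mulr_gt0//.
have -> : gamma / (2 * thetastar r rav) * (1 + S^-1) * Lt ^+ 2 * (2 * gamma)
    = (gamma * A) ^+ 2.
  rewrite exprMn A2 /thetastar -/S; field.
  by rewrite !gt_eqF//; lra.
have p0 : 0 <= gamma * A by rewrite mulr_ge0// ltW.
have q0 : 0 <= gamma * L by rewrite mulr_ge0// ltW.
by move: hg; rewrite mulrDr; nra.
Qed.

End Stepsize.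

(** * Descent of the Lyapunov function along EF-BV *)

Section EFBVAnalysis.
Context {R : realType} {d n : nat} {dT : measure_display} {T : measurableType dT}.
Local Notation vec := 'rV[R]_d.
Variables (P : nat -> probability T R).
Variables (f : 'I_n -> vec -> R) (gradf : 'I_n -> vec -> vec).
Variables (Li : 'I_n -> R) (L : R) (Rg : vec -> \bar R) (xstar : vec).
Variables (C : nat -> 'I_n -> T -> vec -> vec) (eta omega omega_av : R).
Variables (x0 : vec) (h0 : 'I_n -> vec) (gamma lam nu mu : R).
Let r := rconst lam eta omega.
Let rav := rconst nu eta omega_av.
Let F := favg f.
Let gF := gavg gradf.
Let S := sstar r.
Let theta := thetastar r rav.
Let c := 1 + gamma * mu / 2.
Let rho := Num.max c^-1 ((r + 1) / 2).
Local Notation state := (efbv_state gradf Rg gamma lam nu C x0 h0).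
Local Notation PsiT := (Psi f gradf Rg xstar gamma lam nu theta C x0 h0).

Hypotheses (n0 : (0 < n)%N) (cf : forall i, convex_fun (f i)).
Hypotheses (df : forall i, is_gradient (f i) (gradf i)).
Hypotheses (lf : forall i, lipschitz_map (gradf i) (Li i)).
Hypotheses (L0 : 0 <= L) (lF : lipschitz_map gF L).
Hypotheses (pR : proper_ext Rg) (cR : convex_ext Rg) (clR : closed_ext Rg).
Hypotheses (minF : is_minimizer F Rg xstar).
Hypotheses (cC : forall t i, compressor_class (P t) (C t i) eta omega).
Hypotheses (avC : forall t, omega_av_bound (P t) (C t) omega_av).
Hypotheses (r01 : 0 < r < 1) (rav0 : 0 < rav) (mu0 : 0 < mu).
Hypotheses (KL : KL_half F gF Rg xstar mu).
Hypotheses (nu01 : 0 <= nu <= 1) (lam01 : 0 <= lam <= 1) (g0 : 0 < gamma).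
Hypothesis hgamma :
  gamma * (2 * L + Ltilde Li * Num.sqrt (rav / r) * (sstar r)^-1) <= 1.

Let nR : 0 <= n%:R^-1 :> R. Proof. by rewrite invr_ge0. Qed.
Let S0 : 0 < S. Proof. exact: sstar_gt0. Qed.
Let theta0 : 0 < theta.
Proof.
have /andP[r0 _] := r01.
by rewrite /theta /thetastar -/S !mulr_gt0 ?invr_gt0// addr_gt0.
Qed.
Let c0 : 0 < c. Proof. by rewrite /c addr_gt0// divr_gt0// mulr_gt0. Qed.
Let rho0 : 0 < rho. Proof. by rewrite lt_max invr_gt0 c0. Qed.
Let kappa := gamma / (2 * theta).
Let kappa0 : 0 < kappa. Proof. by rewrite divr_gt0// mulr_gt0. Qed.

Definition shift_error (x : vec) (hs : 'I_n -> vec) : R :=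
  n%:R^-1 * \sum_(i < n) sqnorm (gradf i x - hs i).

Lemma shift_error_ge0 x hs : 0 <= shift_error x hs.
Proof. by apply: mulr_ge0 => //; apply: sumr_ge0 => i _; exact: sqnorm_ge0. Qed.

Let rs := fine (Rg xstar).

Lemma minimizer_value : Rg xstar = rs%:E.
Proof.
apply/esym/fineK; rewrite fin_numE pR.1 /=; apply/eqP => E.
have [z zfin] := pR.2; have := minF z; rewrite E -(fineK zfin).
by rewrite addeC.
Qed.

Let gap x rx := F x + rx - F xstar - rs.

(** Young's inequality with weight [S] in each summand, then the Lipschitz bounds, whose squared
    constants average to [Ltilde Li ^+ 2]. *)
Lemma shift_error_drift x x' hs :
  shift_error x' hs <= (1 + S) * shift_error x hs
    + (1 + S^-1) * Ltilde Li ^+ 2 * sqnorm (x' - x).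
Proof.
rewrite /Ltilde sqr_sqrtr; last first.
  by apply: mulr_ge0 => //; apply: sumr_ge0 => i _; rewrite sqr_ge0.
rewrite /shift_error; set q := sqnorm _.
set A := \sum_i sqnorm (gradf i x - hs i); set B := \sum_i Li i ^+ 2.
have -> : (1 + S) * (n%:R^-1 * A) + (1 + S^-1) * (n%:R^-1 * B) * q
    = n%:R^-1 * ((1 + S) * A + (1 + S^-1) * (B * q)) by ring.
rewrite ler_wpM2l// /A /B mulr_suml !mulr_sumr -big_split /=.
apply: ler_sum => i _.
have -> : gradf i x' - hs i = (gradf i x - hs i) + (gradf i x' - gradf i x).
  by rewrite [RHS]addrC addrA subrK.
apply: le_trans (sqnormD_young S _ _ S0) _; rewrite lerD2l.
rewrite ler_wpM2l ?addr_ge0 ?invr_ge0 ?(ltW S0)//.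
by apply: sqnorm_le_sqr; exact: lf.
Qed.

(** [D] holds the compressed vectors. The next iterate does not occur, so taking the mean asks
    nothing of the proximal map. *)
Definition lyapunov_bound x rx (hs : 'I_n -> vec) (D : 'I_n -> vec) : R :=
  gap x rx / c
  + gamma / 2 * sqnorm (n%:R^-1 *: \sum_i ((gradf i x - hs i) - nu *: D i))
  + kappa * (1 + S) * (n%:R^-1 * \sum_i sqnorm ((gradf i x - hs i) - lam *: D i)).

(** For every realization of the compressors, the inexact step controls the gap, the drift bound
    controls the shift error, and the stepsize condition absorbs the drift in [|x' - x|^2]. *)
Lemma efbv_step_descent x rx hs (Cm : 'I_n -> vec -> vec) x' hs' hb' :
  Rg x = rx%:E ->
  efbv_step gradf Rg gamma lam nu Cm (x, hs, n%:R^-1 *: \sum_i hs i)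
    = (x', hs', hb') ->
  exists r', Rg x' = r'%:E /\
    gap x' r' + kappa * shift_error x' hs'
      <= lyapunov_bound x rx hs (fun i => Cm i (gradf i x - hs i)).
Proof.
move=> gx [<- <- _]; set D := fun i => Cm i _; set v := _ + nu *: _.
have [r' /= [gx' h]] := inexact_prox_gradient_step F gF L Rg xstar rs mu
  (favg_convex f cf) (favg_gradient f gradf df) lF pR cR clR minF minimizer_value
  mu0 KL gamma x rx v g0 gx.
exists r'; split=> //; move: h; set y := prox _ _ _ => h.
rewrite -/(gap y r') -/(gap x rx) -/c in h.
have := shift_error_drift x y (fun i => hs i + lam *: D i).
move=> /(ler_wpM2l (ltW kappa0)).
have := stepsize_absorbs_drift r rav gamma L (Ltilde Li) r01 rav0 g0 L0
  (sqrtr_ge0 _) hgamma.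
move=> /(ler_wpM2r (sqnorm_ge0 (y - x))); rewrite -/S -/theta -/kappa => h1 h2.
rewrite /lyapunov_bound.
(* The third state component is the average of the [hs i], so the error of the gradient estimate is
   an average of compression errors. *)
have -> : n%:R^-1 *: \sum_i (gradf i x - hs i - nu *: D i) = gF x - v.
  rewrite /gF /gavg /v !scaler_sumr -big_split /= -sumrB; apply: eq_bigr => i _.
  by apply/rowP => j; rewrite !mxE; ring.
have -> : n%:R^-1 * \sum_i sqnorm (gradf i x - hs i - lam *: D i)
    = shift_error x (fun i => hs i + lam *: D i).
  by congr (_ * _); apply: eq_bigr => i _; rewrite opprD addrA.
move: h h1 h2; rewrite mulrDr; lra.
Qed.

Lemma mean_lyapunov_bound t x rx hs : Rg x = rx%:E ->
  exists2 v, mean_le (P t) (fun s => lyapunov_bound x rx hs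
                              (fun i => C t i s (gradf i x - hs i))) v
    & v <= rho * (gap x rx + kappa * shift_error x hs).
Proof.
move=> gx; have gap0 : 0 <= gap x rx.
  exact: (gap_ge0 F Rg xstar rs minF minimizer_value).
have e0 := shift_error_ge0 x hs; pose w i := gradf i x - hs i.
exists (gap x rx / c + gamma / 2 * (rav * shift_error x hs)
    + kappa * (1 + S) * (n%:R^-1 * \sum_i (r * sqnorm (w i)))).
  apply: mean_leD; first apply: mean_leD.
  - by apply: mean_le_cst; rewrite divr_ge0// ltW.
  - apply: mean_leZ; first by rewrite divr_ge0// ltW.
    exact: (gradient_estimate_error_le (P t) eta n nu omega omega_av (C t) w
             n0 nu01 (cC t) (avC t)).
  - apply: mean_leZ; first by apply: mulr_ge0; [exact: ltW|apply: addr_ge0 => //; exact: ltW].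
    apply: mean_leZ => //; apply: mean_le_sum => i.
    exact: (control_variate_error_le (P t) eta lam omega (C t i) (w i)
             lam01 (cC t i)).
rewrite -mulr_sumr (mulrCA _ r) -/(shift_error x hs).
(* [theta] balances the two errors: [gamma / 2 * rav] equals [kappa S (1 + S) r], and adding
   [kappa (1 + S) r] gives [kappa (1 + S)^2 r]. *)
have E : gamma / 2 * (rav * shift_error x hs)
      + kappa * (1 + S) * (r * shift_error x hs)
    = kappa * ((r + 1) / 2 * shift_error x hs).
  have /andP[rp _] := r01.
  rewrite [r + 1]addrC -(sstar_rate r r01) -/S /kappa /theta /thetastar -/S.
  by field; rewrite !gt_eqF// addr_gt0.
rewrite -addrA E mulrDr lerD//.
  by rewrite mulrC ler_wpM2r// le_max lexx.
rewrite (mulrCA rho) ler_wpM2l ?(ltW kappa0)// ler_wpM2r//.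
by rewrite le_max lexx orbT.
Qed.

Lemma efbv_state_upd t xi k s : (t <= k)%N -> state t (upd xi k s) = state t xi.
Proof.
elim: t => //= t IH tk; rewrite IH ?(ltnW tk)//.
by rewrite /upd (ltn_eqF tk).
Qed.

Lemma efbv_hbar t xi :
  let: (_, hs, hb) := state t xi in hb = n%:R^-1 *: \sum_i hs i.
Proof.
elim: t => //= t; case: (state t xi) => [[x hs] hb] /= ->.
by rewrite big_split /= -scaler_sumr scalerDr scalerA mulrC -scalerA.
Qed.

Lemma PsiE t xi x hs hb rx : state t xi = (x, hs, hb) -> Rg x = rx%:E ->
  PsiT t xi = (gap x rx + kappa * shift_error x hs)%:E.
Proof.
by move=> E gx; rewrite /Psi E gx minimizer_value.
Qed.

(** Serves starting states outside the domain of [Rg], where the right side of the claimed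
    inequality is infinite. *)
Lemma Psi_pinfty t xi x hs hb : state t xi = (x, hs, hb) -> Rg x = +oo%E ->
  PsiT t xi = +oo%E.
Proof. by move=> E gx; rewrite /Psi E gx minimizer_value. Qed.

Lemma Psi_ge0 t xi : (0 <= PsiT t xi)%E.
Proof.
case E : (state t xi) => [[x hs] hb]; case gx : (Rg x) => [rx| |].
- rewrite (PsiE _ _ _ _ _ _ E gx) lee_fin addr_ge0//.
    exact: (gap_ge0 F Rg xstar rs minF minimizer_value).
  by rewrite mulr_ge0 ?shift_error_ge0// ltW.
- by rewrite (Psi_pinfty _ _ _ _ _ E gx).
- by have := pR.1 x; rewrite gx.
Qed.

Lemma Eiter_ge0 m k (G : (nat -> T) -> \bar R) xi :
  (forall zeta, (0 <= G zeta)%E) -> (0 <= Eiter P m k G xi)%E.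
Proof.
by move=> G0; elim: m k xi => //= m IH k xi; apply: integral_ge0 => s _; exact: IH.
Qed.

(** Induction on the number [m] of seeds left, with the time [k] and the past [xi] free. The
    hypothesis bounds the inner expectation by [rho^m] times the next value of [PsiT], which
    [lyapunov_bound] dominates pathwise; only then is the mean over the seed of time [k] taken. *)
Lemma Eiter_Psi_le m k xi :
  (Eiter P m k (PsiT (k + m)) xi <= (rho ^+ m)%:E * PsiT k xi)%E.
Proof.
elim: m k xi => [|m IH] k xi; first by rewrite addn0 expr0 mul1e.
have rm0 j : 0 < rho ^+ j by exact: exprn_gt0.
case E : (state k xi) => [[x hs] hb]; case gx : (Rg x) => [rx| |]; last 2 first.
- by rewrite (Psi_pinfty _ _ _ _ _ E gx) gt0_muley ?lte_fin// leey.
- by have := pR.1 x; rewrite gx.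
have [v [mB B0 hB] hv] := mean_lyapunov_bound k x rx hs gx.
rewrite (PsiE _ _ _ _ _ _ E gx) /=.
have [_ _ hmB] := mean_leZ (P k) _ _ _ (ltW (rm0 m)) (And3 mB B0 hB).
apply: le_trans (le_trans hmB _); last first.
  by rewrite -EFinM lee_fin exprSr -mulrA ler_wpM2l// ltW.
(* The inner expectation is not known to be measurable in [s], so it is compared pointwise with the
   measurable bound. *)
apply: ge0_le_lower_integral => s; apply/andP; split.
  by apply: Eiter_ge0 => zeta; exact: Psi_ge0.
rewrite -addSnnS; apply: le_trans (IH _ _) _.
rewrite EFinM lee_wpmul2l ?lee_fin ?(ltW (rm0 m))//.
have hbE := efbv_hbar k xi; rewrite E in hbE.
case E' : (efbv_step gradf Rg gamma lam nu (fun i => C k i s) (x, hs, hb)) => [[x' hs'] hb'].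
rewrite (_ : efbv_step _ _ _ _ _ _ _ = state k.+1 (upd xi k s)) in E'; last first.
  by rewrite [RHS]/= efbv_state_upd// E /upd eqxx.
have [r' [gx' h]] : exists r', Rg x' = r'%:E /\
    gap x' r' + kappa * shift_error x' hs'
      <= lyapunov_bound x rx hs (fun i => C k i s (gradf i x - hs i)).
  apply: (efbv_step_descent _ _ _ (fun i => C k i s) _ _ hb' gx).
  by rewrite -hbE -E' [RHS]/= efbv_state_upd// E /upd eqxx.
by rewrite (PsiE _ _ _ _ _ _ E' gx') lee_fin.
Qed.

End EFBVAnalysis.

Theorem theorem2 (R : realType) (d n : nat)
  (dT : measure_display) (T : measurableType dT) (P : nat -> probability T R)
  (f : 'I_n -> 'rV[R]_d -> R) (gradf : 'I_n -> 'rV[R]_d -> 'rV[R]_d)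
  (Li : 'I_n -> R) (L : R) (Rg : 'rV[R]_d -> \bar R) (xstar : 'rV[R]_d)
  (C : nat -> 'I_n -> T -> 'rV[R]_d -> 'rV[R]_d) (eta omega omega_av : R)
  (x0 : 'rV[R]_d) (h0 : 'I_n -> 'rV[R]_d) (gamma lam nu mu : R) :
  (0 < n)%N ->
  (forall i, convex_fun (f i)) ->
  (forall i, is_gradient (f i) (gradf i)) ->
  (forall i, 0 <= Li i) ->
  (forall i, lipschitz_map (gradf i) (Li i)) ->
  0 <= L -> lipschitz_map (gavg gradf) L -> L <= Ltilde Li ->
  proper_ext Rg -> convex_ext Rg -> closed_ext Rg ->
  is_minimizer (favg f) Rg xstar ->
  0 <= eta < 1 -> 0 <= omega_av <= omega ->
  (forall t i, compressor_class (P t) (C t i) eta omega) ->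
  (forall t, omega_av_bound (P t) (C t) omega_av) ->
  0 < rconst lam eta omega -> 0 < rconst nu eta omega_av ->
  0 < mu -> KL_half (favg f) (gavg gradf) Rg xstar mu ->
  0 < nu <= 1 -> 0 < lam <= 1 -> rconst lam eta omega < 1 ->
  let r := rconst lam eta omega in
  let rav := rconst nu eta omega_av in
  0 < gamma ->
  gamma * (2 * L + Ltilde Li * Num.sqrt (rav / r) * (sstar r)^-1) <= 1 ->
  forall (t : nat) (xi : nat -> T),
    (Eiter P t 0 (Psi f gradf Rg xstar gamma lam nu (thetastar r rav) C x0 h0 t) xi
     <= ((Num.max (1 + gamma * mu / 2)^-1 ((r + 1) / 2)) ^+ t)%:E
        * Psi f gradf Rg xstar gamma lam nu (thetastar r rav) C x0 h0 0 xi)%E.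
Proof.
move=> n0 cf df _ lf L0 lF _ pR cR clR minF _ _ cC avC r0 rav0 mu0 KL.
move=> /andP[/ltW nu0 nu1] /andP[/ltW lam0 lam1] r1 r rav g0 hg t xi.
have r01 : 0 < rconst lam eta omega < 1 by rewrite r0 r1.
have nu01 : 0 <= nu <= 1 by rewrite nu0 nu1.
have lam01 : 0 <= lam <= 1 by rewrite lam0 lam1.
(* At time 0 all [t] seeds remain to be drawn, and [0 + t] computes to [t]. *)
exact: (Eiter_Psi_le P f gradf Li L Rg xstar C eta omega omega_av x0 h0 gamma
  lam nu mu n0 cf df lf L0 lF pR cR clR minF cC avC r01 rav0 mu0 KL nu01 lam01
  g0 hg t 0 xi).
Qed.
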